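(* Let $(X,d)$ be a complete metric space and let $G:X\times X\to X$ be a mapping such that (i) $G(x,x)=x$ for all $x\in X$, and (ii) for $x,y\in X$, $G(x,y)=x$ implies $y=x$. Let $T:X\to P_{cl}(X)$ be a multivalued operator with $SFix(T)\neq\emptyset$, let $x^*\in SFix(T)$, and let $T_G(x)=\{G(x,u):u\in T(x)\}$ be the admissible perturbation of $T$ corresponding to $G$. Suppose there exists $k\in(0,1)$ such that $$H(T_G(x),\{x^*\})\le k\,d(x,x^* )\quad\text{for all }x\in X.$$ Then $$H(T_G(Y),\{x^*\})\le k\,H(Y,\{x^*\})\quad\text{for all }Y\in P_{cl}(X).$$
   Context: $P(X)$ denotes the family of nonempty subsets of $X$ and $P_{cl}(X)$ the family of nonempty closed subsets. $SFix(T)=\{x\in X:T(x)=\{x\}\}$. For $A,B\in P(X)$: $D(a,B)=\inf\{d(a,b):b\in B\}$, $e(A,B)=\sup\{D(a,B):a\in A\}$, $H(A,B)=\max\{e(A,B),e(B,A)\}$ (possibly $+\infty$). For $Y\subseteq X$, $T_G(Y)=\bigcup_{y\in Y}T_G(y)$. *)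

(* Defs.v *)
From HB Require Import structures.
From mathcomp Require Import all_boot all_order all_algebra.
From mathcomp Require Import all_classical all_reals.
From mathcomp Require Import ereal.
Set Implicit Arguments. Unset Strict Implicit. Unset Printing Implicit Defensive.
Import Order.TTheory GRing.Theory Num.Theory.
Local Open Scope classical_set_scope.
Local Open Scope ring_scope.

Definition is_metric (R : realType) (X : Type) (d : X -> X -> R) : Prop :=
  (forall x y, 0 <= d x y) /\
  (forall x y, d x y = 0 <-> x = y) /\
  (forall x y, d x y = d y x) /\
  (forall x y z, d x z <= d x y + d y z).

Definition cauchy_seq (R : realType) (X : Type) (d : X -> X -> R) (u : nat -> X) : Prop :=
  forall eps : R, 0 < eps -> exists N : nat, forall m n : nat,
    (N <= m)%N -> (N <= n)%N -> d (u m) (u n) < eps.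

Definition converges_to (R : realType) (X : Type) (d : X -> X -> R) (u : nat -> X) (l : X) : Prop :=
  forall eps : R, 0 < eps -> exists N : nat, forall n : nat, (N <= n)%N -> d (u n) l < eps.

Definition complete_metric (R : realType) (X : Type) (d : X -> X -> R) : Prop :=
  forall u : nat -> X, cauchy_seq d u -> exists l, converges_to d u l.

Definition closed_in (R : realType) (X : Type) (d : X -> X -> R) (A : set X) : Prop :=
  forall (u : nat -> X) (l : X), (forall n, A (u n)) -> converges_to d u l -> A l.

Definition Pcl (R : realType) (X : Type) (d : X -> X -> R) (A : set X) : Prop :=
  A !=set0 /\ closed_in d A.

Definition SFix (X : Type) (T : X -> set X) : set X := [set x | T x = [set x]].

Local Open Scope ereal_scope.
Definition gapD (R : realType) (X : Type) (d : X -> X -> R) (a : X) (B : set X) : \bar R :=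
  ereal_inf [set (d a b)%:E | b in B].
Definition excess (R : realType) (X : Type) (d : X -> X -> R) (A B : set X) : \bar R :=
  ereal_sup [set gapD d a B | a in A].
Definition hausdorff (R : realType) (X : Type) (d : X -> X -> R) (A B : set X) : \bar R :=
  maxe (excess d A B) (excess d B A).
Local Close Scope ereal_scope.

Definition TG (X : Type) (G : X -> X -> X) (T : X -> set X) (x : X) : set X :=
  [set G x u | u in T x].
Definition TG_set (X : Type) (G : X -> X -> X) (T : X -> set X) (Y : set X) : set X :=
  \bigcup_(y in Y) TG G T y.

(* Main.v *)
(* Against a singleton the Hausdorff distance is a plain supremum:
   H(A, {x}) = sup_{a in A} d(a, x) for nonempty A.  Every point of T_G(Y)
   lies in some T_G(y) with y in Y, so its distance to xstar is at most
   H(T_G(y), {xstar}) <= k d(y, xstar) <= k H(Y, {xstar}). *)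
Require Import Defs.
From HB Require Import structures.
From mathcomp Require Import all_boot all_order all_algebra.
From mathcomp Require Import all_classical all_reals.
From mathcomp Require Import ereal.
Set Implicit Arguments. Unset Strict Implicit. Unset Printing Implicit Defensive.
Import Order.TTheory GRing.Theory Num.Theory.
Local Open Scope classical_set_scope.
Local Open Scope ring_scope.

Section hausdorff_to_point.
Variables (R : realType) (X : Type) (d : X -> X -> R).
Local Open Scope ereal_scope.

Lemma gapD_set1 (a x : X) : gapD d a [set x] = (d a x)%:E.
Proof. by rewrite /gapD image_set1 ereal_inf1. Qed.

Lemma excess_set1r (A : set X) (x : X) :
  excess d A [set x] = ereal_sup [set (d a x)%:E | a in A].
Proof.
by rewrite /excess; congr ereal_sup; apply: eq_imagel => a _; exact: gapD_set1.
Qed.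

Lemma excess_set1l (A : set X) (x : X) : excess d [set x] A = gapD d x A.
Proof. by rewrite /excess image_set1 ereal_sup1. Qed.

Hypothesis dC : forall x y, d x y = d y x.

Lemma hausdorff_set1 (A : set X) (x : X) : A !=set0 ->
  hausdorff d A [set x] = ereal_sup [set (d a x)%:E | a in A].
Proof.
move=> [a0 Aa0]; rewrite /hausdorff excess_set1r excess_set1l; apply/max_idPl.
apply: (@le_trans _ _ (d x a0)%:E); first by apply: ereal_inf_lbound; exists a0.
by rewrite dC; apply: ereal_sup_ubound; exists a0.
Qed.

Lemma le_hausdorff_set1 (A : set X) (a x : X) :
  A a -> (d a x)%:E <= hausdorff d A [set x].
Proof.
by move=> Aa; rewrite hausdorff_set1; [apply: ereal_sup_ubound; exists a | exists a].
Qed.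

End hausdorff_to_point.

Lemma TG_set_neq0 (X : Type) (G : X -> X -> X) (T : X -> set X) (Y : set X) :
  Y !=set0 -> (forall y, T y !=set0) -> TG_set G T Y !=set0.
Proof.
move=> [y Yy] /(_ y) [u Tu].
by exists (G y u); exists y => //; exists u.
Qed.

Theorem mainTheorem2 (R : realType) (X : Type) (d : X -> X -> R)
  (hd : is_metric d) (hcomplete : complete_metric d)
  (G : X -> X -> X)
  (hG1 : forall x, G x x = x)
  (hG2 : forall x y, G x y = x -> y = x)
  (T : X -> set X) (hT : forall x, Pcl d (T x))
  (hSFix : SFix T !=set0)
  (xstar : X) (hxstar : SFix T xstar)
  (k : R) (hk0 : 0 < k) (hk1 : k < 1)
  (hcontr : forall x, (hausdorff d (TG G T x) [set xstar] <= (k * d x xstar)%:E)%E) :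
  forall Y : set X, Pcl d Y ->
    (hausdorff d (TG_set G T Y) [set xstar] <= k%:E * hausdorff d Y [set xstar])%E.
Proof.
have [_ [_ [dC _]]] := hd.
move=> Y [Y0 _].
have TGY0 : TG_set G T Y !=set0 by apply: TG_set_neq0 => // y; case: (hT y).
rewrite hausdorff_set1 //; apply: ge_ereal_sup => _ [z [y Yy TGyz] <-].
apply: (le_trans (le_hausdorff_set1 dC xstar TGyz)).
apply: (le_trans (hcontr y)).
rewrite EFinM; apply: lee_wpmul2l; first by rewrite lee_fin ltW.
exact: le_hausdorff_set1.
Qed.
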